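(* The linear map determined by $p_\pi\mapsto R_\pi$, for $\pi$ ranging over all set partitions in $\bigcup_{n\ge0}\Pi_n$, is an algebra isomorphism from $NCSym$ (the algebra of symmetric functions in noncommuting variables over $\mathbb{Q}$) onto $\mathbb{Q}\mathcal{R}$ (the algebra of rook placements on upper-triangular boards with the extended direct sum $\hat{\oplus}$ as product).
   Context: Set partitions: $[n]=\{1,\ldots,n\}$ and $\Pi_n$ is the set of all set partitions of $[n]$; $\Pi_0$ consists of the empty partition. $NCSym$: Let $X=\{x_1,x_2,\ldots\}$ be a countably infinite set of noncommuting variables and $\mathbb{Q}\langle\langle X\rangle\rangle$ the ring of formal power series in them over $\mathbb{Q}$. The symmetric group $\mathfrak{S}_m$ acts on monomials by $g(x_{i_1}x_{i_2}\cdots x_{i_n})=x_{g^{-1}(i_1)}x_{g^{-1}(i_2)}\cdots x_{g^{-1}(i_n)}$, where $g(i)=i$ for $i>m$, and the action is extended linearly to $\mathbb{Q}\langle\langle X\rangle\rangle$. $NCSym\subset\mathbb{Q}\langle\langle X\rangle\rangle$ is the subalgebra of all power series of bounded degree invariant under the action of $\mathfrak{S}_m$ for all $m\ge0$. For a monomial $x=x_{i_1}\cdots x_{i_n}$, $\pi_x\in\Pi_n$ is the set partition in which $j$ and $k$ are in the same block if and only if $i_j=i_k$. For $\pi\in\Pi_n$, the power sum symmetric function in noncommuting variables is $p_\pi=\sum_{x:\pi_x\ge\pi}x$, the sum over monomials $x$ of degree $n$ such that $\pi_x$ is obtained by merging blocks of $\pi$ (possibly $\pi_x=\pi$); for the empty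 partition, $p_\pi=1$. The $p_\pi$, over all $\pi\in\bigcup_{n\ge0}\Pi_n$, form a vector space basis of $NCSym$. Rooks: A rook (placement) is an $n\times n$ matrix of $0$'s and $1$'s with at most one $1$ in every row and column. $\mathcal{T}_n=\{(i,j)\in[n]\times[n] : i\le j\}$, and a rook $R$ is on $\mathcal{T}_n$, written $R\subseteq\mathcal{T}_n$, if $R$ is $n\times n$ and $R_{i,j}=1$ implies $(i,j)\in\mathcal{T}_n$. On $\mathcal{T}_0$ there is the single empty ($0\times0$) rook, and on $\mathcal{T}_{-1}$ there is by convention a single rook, called the unit rook and denoted $1$, distinct from the empty rook on $\mathcal{T}_0$. Let $\mathcal{R}=\{R\subseteq\mathcal{T}_n : n\ge-1\}$. Bijection: For $n\ge1$ and $\pi\in\Pi_n$, $R_\pi$ is the $(n-1)\times(n-1)$ rook on $\mathcal{T}_{n-1}$ with $(R_\pi)_{i,j}=1$ exactly when $i$ and $j+1$ are adjacent elements in a block of $\pi$ whose elements are listed in increasing order (i.e., $i<j+1$ lie in the same block with no element of that block strictly between them). For the empty partition, $R_\pi$ is the unit rook. This gives a bijection from $\bigcup_{n\ge0}\Pi_n$ to $\mathcal{R}$. Algebra $\mathbb{Q}\mathcal{R}$: $\mathbb{Q}\mathcal{R}$ is the $\mathbb{Q}$-vector space of formal linear combinations of elements of $\mathcal{R}$. For matrices $R,S$, the extended direct sum is $R\,\hat{\oplus}\,S=R\oplus(0)\oplus S$, where $\oplus$ is ordinary matrix direct sum (block diagonal) and $(0)$ is the $1\times1$ zero matrix. The product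 on $\mathbb{Q}\mathcal{R}$ is $\hat{\oplus}$ extended bilinearly, with the unit rook acting as a two-sided identity; this makes $\mathbb{Q}\mathcal{R}$ an algebra. *)

(* Defs.v *)
From HB Require Import structures.
From mathcomp Require Import all_boot all_order all_algebra all_fingroup.
From mathcomp Require Import boolp functions zify.
From mathcomp Require Import monalg.

Set Implicit Arguments.
Unset Strict Implicit.
Unset Printing Implicit Defensive.

Import GRing.Theory.

Local Open Scope ring_scope.

(* The ring Q<<X>>. The variables are indexed from 0, so that x_(i+1) is the  *)
(* variable of index i; a monomial is the word of the indices of its          *)
(* variables, and a power series is the family of its coefficients.           *)
Definition ncseries := seq nat -> rat.

HB.instance Definition _ := GRing.Zmodule.copy ncseries (seq nat -> rat).

Implicit Types (f g h : ncseries) (w : seq nat).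

Definition ncseries_scale (a : rat) f : ncseries := fun w => a * f w.

Lemma ncseries_scaleA a b f :
  ncseries_scale a (ncseries_scale b f) = ncseries_scale (a * b) f.
Proof. by apply/funext => w; exact: mulrA. Qed.

Lemma ncseries_scale1 : left_id 1 ncseries_scale.
Proof. by move=> f; apply/funext => w; exact: mul1r. Qed.

Lemma ncseries_scaleDr : right_distributive ncseries_scale +%R.
Proof. by move=> a f g; apply/funext => w; exact: mulrDr. Qed.

Lemma ncseries_scaleDl f : {morph ncseries_scale^~ f : a b / a + b}.
Proof. by move=> a b; apply/funext => w; exact: mulrDl. Qed.

HB.instance Definition _ := GRing.Zmodule_isLmodule.Build rat ncseries
  ncseries_scaleA ncseries_scale1 ncseries_scaleDr ncseries_scaleDl.

Definition ncseries_one : ncseries := fun w => (w == [::])%:R.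

Definition ncseries_mul f g : ncseries :=
  fun w => \sum_(i < (size w).+1) f (take i w) * g (drop i w).

Lemma ncseries_mul_nil f g : ncseries_mul f g [::] = f [::] * g [::].
Proof. by rewrite /ncseries_mul big_ord1. Qed.

Lemma ncseries_mul_cons f g x w :
  ncseries_mul f g (x :: w) =
  f [::] * g (x :: w) + ncseries_mul (fun u => f (x :: u)) g w.
Proof. by rewrite /ncseries_mul big_ord_recl. Qed.

Lemma ncseries_mulDl : left_distributive ncseries_mul +%R.
Proof.
move=> f g h; apply/funext => w; rewrite /ncseries_mul.
transitivity (\sum_(i < (size w).+1)
  (f (take i w) * h (drop i w) + g (take i w) * h (drop i w))).
  by apply: eq_bigr => i _; rewrite -mulrDl.
by rewrite big_split.
Qed.

Lemma ncseries_mulDr : right_distributive ncseries_mul +%R.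
Proof.
move=> f g h; apply/funext => w; rewrite /ncseries_mul.
transitivity (\sum_(i < (size w).+1)
  (f (take i w) * g (drop i w) + f (take i w) * h (drop i w))).
  by apply: eq_bigr => i _; rewrite -mulrDr.
by rewrite big_split.
Qed.

Lemma ncseries_mulZl (a : rat) f g :
  a *: ncseries_mul f g = ncseries_mul (a *: f) g.
Proof.
apply/funext => w; rewrite /ncseries_mul.
transitivity (a * \sum_(i < (size w).+1) f (take i w) * g (drop i w)) => //.
by rewrite mulr_sumr; apply: eq_bigr => i _; rewrite mulrA.
Qed.

Lemma ncseries_mulZr (a : rat) f g :
  a *: ncseries_mul f g = ncseries_mul f (a *: g).
Proof.
apply/funext => w; rewrite /ncseries_mul.
transitivity (a * \sum_(i < (size w).+1) f (take i w) * g (drop i w)) => //.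
by rewrite mulr_sumr; apply: eq_bigr => i _; rewrite mulrCA.
Qed.

Lemma ncseries_mul1l : left_id ncseries_one ncseries_mul.
Proof.
move=> f; apply/funext => w; rewrite /ncseries_mul big_ord_recl /=.
rewrite take0 drop0 mul1r big1 ?addr0 // => i _.
by case: w i => [|x w] [i lt_i] //=; rewrite mul0r.
Qed.

Lemma ncseries_mul1r : right_id ncseries_one ncseries_mul.
Proof.
move=> f; apply/funext => w; rewrite /ncseries_mul big_ord_recr /=.
rewrite take_size drop_size mulr1 big1 ?add0r // => i _.
rewrite /ncseries_one -size_eq0 size_drop subn_eq0 leqNgt ltn_ord.
by rewrite mulr0.
Qed.

Lemma ncseries_mulA : associative ncseries_mul.
Proof.
move=> f g h; apply/funext => w; elim: w f g h => [|x w IHw] f g h.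
  by rewrite !ncseries_mul_nil mulrA.
rewrite !ncseries_mul_cons ncseries_mul_nil IHw mulrDr mulrA -addrA.
congr (_ + _).
have -> : (fun u => ncseries_mul f g (x :: u)) =
    f [::] *: ((fun u => g (x :: u)) : ncseries) +
    ncseries_mul (fun u => f (x :: u)) g
    :> ncseries.
  by apply/funext => u; rewrite ncseries_mul_cons.
by rewrite ncseries_mulDl -ncseries_mulZl.
Qed.

Lemma ncseries_one_neq0 : ncseries_one != 0.
Proof. by apply/eqP => /(congr1 (fun f : ncseries => f [::])). Qed.

HB.instance Definition _ := GRing.Zmodule_isNzRing.Build ncseries
  ncseries_mulA ncseries_mul1l ncseries_mul1r ncseries_mulDl ncseries_mulDr
  ncseries_one_neq0.
HB.instance Definition _ := GRing.Lmodule_isLalgebra.Build rat ncseries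
  ncseries_mulZl.
HB.instance Definition _ := GRing.Lalgebra_isAlgebra.Build rat ncseries
  ncseries_mulZr.

Definition perm_ext m (s : 'S_m) (i : nat) : nat :=
  if insub i is Some j then val (s j) else i.

Definition act_word m (s : 'S_m) w : seq nat := map (perm_ext s^-1%g) w.

(* The linear extension maps \sum_u f_u u to \sum_u f_u (s u), in which the   *)
(* coefficient of w is that of s^-1 w in f.                                   *)
Definition act_series m (s : 'S_m) f : ncseries :=
  fun w => f (act_word s^-1%g w).

Definition bounded_degree f := exists d, forall w, (d < size w)%N -> f w = 0.

Definition ncsym_pred : {pred ncseries} := fun f =>
  `[< bounded_degree f /\ forall m (s : 'S_m), act_series s f = f >].

Lemma ncsym_predP f :
  reflect (bounded_degree f /\ forall m (s : 'S_m), act_series s f = f)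
          (f \in ncsym_pred).
Proof. exact: asboolP. Qed.

Lemma ncsym_subalg_closed : GRing.subalg_closed ncsym_pred.
Proof.
split.
- apply/ncsym_predP; split; first by exists 0%N => - [].
  by move=> m s; apply/funext => - [].
- move=> a f g /ncsym_predP[[d df] sf] /ncsym_predP[[e eg] sg].
  apply/ncsym_predP; split.
    exists (maxn d e) => w; rewrite gtn_max => /andP[ltd lte].
    have -> : (a *: f + g) w = a * f w + g w by [].
    by rewrite df // eg // mulr0 addr0.
  move=> m s; have -> : act_series s (a *: f + g) =
    a *: act_series s f + act_series s g by [].
  by rewrite sf sg.
- move=> f g /ncsym_predP[[d df] sf] /ncsym_predP[[e eg] sg].
  apply/ncsym_predP; split.
    exists (d + e)%N => w ltw; apply: big1 => i _.
    have [lti|lei] := ltnP d i.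
      rewrite df ?mul0r // size_takel //.
      by rewrite -ltnS.
    rewrite eg ?mulr0 // size_drop ltn_subRL.
    by apply: leq_ltn_trans ltw; rewrite leq_add2r.
  move=> m s; rewrite -{2}(sf m s) -{2}(sg m s); apply/funext => w.
  rewrite /act_series /act_word.
  transitivity (ncseries_mul f g [seq perm_ext s^-1^-1%g i | i <- w]) => //.
  rewrite /ncseries_mul size_map; apply: eq_bigr => i _.
  by rewrite map_take map_drop.
Qed.

HB.instance Definition _ :=
  GRing.isSubalgClosed.Build rat ncseries ncsym_pred ncsym_subalg_closed.

Record NCSym := MkNCSym {
  ncsym_val :> ncseries;
  ncsym_valP : ncsym_val \in ncsym_pred
}.

HB.instance Definition _ := [isSub for ncsym_val].
HB.instance Definition _ := [Choice of NCSym by <:].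
HB.instance Definition _ := [SubChoice_isSubAlgebra of NCSym by <:].

Record setpart n := SetPart {
  blocks :> {set {set 'I_n}};
  setpartP : partition blocks [set: 'I_n]
}.

HB.instance Definition _ n := [isSub for @blocks n].
HB.instance Definition _ n := [Finite of setpart n by <:].

Definition refines n (P Q : {set {set 'I_n}}) : bool :=
  [forall B in P, [exists C in Q, B \subset C]].

(* The partition pi_w, for a word w of length n.                              *)
Definition word_part n w : {set {set 'I_n}} :=
  preim_partition (fun j : 'I_n => nth 0%N w j) [set: 'I_n].

Definition power_sum_series n (P : setpart n) : ncseries :=
  fun w => ((size w == n) && refines P (word_part n w))%:R.

Lemma perm_ext_inj m (s : 'S_m) : injective (perm_ext s).
Proof.
have lt_ext t j : (j < m)%N -> (perm_ext (t : 'S_m) j < m)%N.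
  by move=> lt_j; rewrite /perm_ext insubT /=.
have ext_id t j : (m <= j)%N -> perm_ext (t : 'S_m) j = j.
  by move=> le_j; rewrite /perm_ext insubN // -leqNgt.
apply: (can_inj (g := perm_ext s^-1%g)) => j.
have [lt_j|le_j] := ltnP j m; last by rewrite !ext_id.
rewrite {2}/perm_ext insubT /= /perm_ext insubT //= => lt_sj.
have -> : Sub (s (Ordinal lt_j) : nat) lt_sj = s (Ordinal lt_j).
  exact: val_inj.
by rewrite permK.
Qed.

Lemma power_sum_subproof n (P : setpart n) : power_sum_series P \in ncsym_pred.
Proof.
apply/ncsym_predP; split.
  by exists n => w ltw; rewrite /power_sum_series (gtn_eqF ltw).
move=> m s; apply/funext => w.
rewrite /act_series /power_sum_series size_map.
case: eqP => //= sz_w; congr ((refines _ _)%:R).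
rewrite /word_part /preim_partition /equivalence_partition.
apply: eq_imset => i; apply/setP => j; rewrite !inE /=.
by rewrite !(nth_map 0%N) ?sz_w // (inj_eq (@perm_ext_inj _ _)).
Qed.

Definition power_sum n (P : setpart n) : NCSym :=
  MkNCSym (power_sum_subproof P).

Definition is_rook n (R : 'M[bool]_n) : bool :=
  [forall i, (#|[set j | R i j]| <= 1)%N] &&
  [forall j, (#|[set i | R i j]| <= 1)%N].

Definition on_triangle n (R : 'M[bool]_n) : bool :=
  [forall i : 'I_n, forall j : 'I_n, R i j ==> (i <= j)%N].

Record board_rook n := BoardRook {
  board_mx :> 'M[bool]_n;
  board_rookP : is_rook board_mx && on_triangle board_mx
}.

HB.instance Definition _ n := [isSub for @board_mx n].
HB.instance Definition _ n := [Finite of board_rook n by <:].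

(* UnitRook is the rook on T_(-1), and Rook n R a rook R on T_n.              *)
Inductive rook := UnitRook | Rook n of board_rook n.

Definition rook_encode (r : rook) : option {n : nat & board_rook n} :=
  if r is Rook n R then Some (Tagged board_rook R) else None.
Definition rook_decode (t : option {n : nat & board_rook n}) : rook :=
  if t is Some u then Rook (tagged u) else UnitRook.
Lemma rook_encodeK : cancel rook_encode rook_decode. Proof. by case. Qed.

HB.instance Definition _ := Countable.copy rook (can_type rook_encodeK).

Lemma board_rook_spec n (R : 'M[bool]_n) :
  reflect [/\ forall i j1 j2, R i j1 -> R i j2 -> j1 = j2,
              forall i1 i2 j, R i1 j -> R i2 j -> i1 = i2 &
              forall i j, R i j -> (i <= j)%N]
          (is_rook R && on_triangle R).
Proof.
apply: (iffP idP) => [/andP[/andP[/forallP r /forallP c] /forallP t]|[r c t]].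
  split=> [i j1 j2 R1 R2|i1 i2 j R1 R2|i j Rij].
  - by apply: (card_le1_eqP (r i)); rewrite inE.
  - by apply: (card_le1_eqP (c j)); rewrite inE.
  - by have /forallP/(_ j)/implyP := t i; apply.
apply/andP; split; first (apply/andP; split).
- apply/forallP=> i; apply/card_le1_eqP=> j1 j2; rewrite !inE => R1 R2.
  exact: r R2 R1.
- apply/forallP=> j; apply/card_le1_eqP=> i1 i2; rewrite !inE => R1 R2.
  exact: c R2 R1.
- by apply/forallP=> i; apply/forallP=> j; apply/implyP; exact: t.
Qed.

Definition direct_sum m n (R : 'M[bool]_m) (S : 'M[bool]_n) : 'M[bool]_(m + n) :=
  block_mx R (const_mx false) (const_mx false) S.

Definition ext_direct_sum m n (R : 'M[bool]_m) (S : 'M[bool]_n) :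
    'M[bool]_(m + 1 + n) :=
  direct_sum (direct_sum R (const_mx false : 'M_1)) S.

Lemma direct_sum_board m n (R : 'M[bool]_m) (S : 'M[bool]_n) :
  is_rook R && on_triangle R -> is_rook S && on_triangle S ->
  is_rook (direct_sum R S) && on_triangle (direct_sum R S).
Proof.
move=> /board_rook_spec[r1 c1 t1] /board_rook_spec[r2 c2 t2].
apply/board_rook_spec; split=> [i j1 j2|i1 i2 j|i j].
- rewrite -(fintype.splitK i) -(fintype.splitK j1) -(fintype.splitK j2).
  case: (fintype.split i) (fintype.split j1) (fintype.split j2) => i' [] j1' [] j2' /=;
  rewrite ?block_mxEul ?block_mxEur ?block_mxEdl ?block_mxEdr ?mxE //.
  + by move=> h1 h2; rewrite (r1 _ _ _ h1 h2).
  + by move=> h1 h2; rewrite (r2 _ _ _ h1 h2).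
- rewrite -(fintype.splitK j) -(fintype.splitK i1) -(fintype.splitK i2).
  case: (fintype.split j) (fintype.split i1) (fintype.split i2) => i' [] j1' [] j2' /=;
  rewrite ?block_mxEul ?block_mxEur ?block_mxEdl ?block_mxEdr ?mxE //.
  + by move=> h1 h2; rewrite (c1 _ _ _ h1 h2).
  + by move=> h1 h2; rewrite (c2 _ _ _ h1 h2).
- rewrite -(fintype.splitK i) -(fintype.splitK j).
  case: (fintype.split i) (fintype.split j) => i' [] j' /=;
  rewrite ?block_mxEul ?block_mxEur ?block_mxEdl ?block_mxEdr ?mxE //.
  + exact: t1.
  + by rewrite leq_add2l; exact: t2.
Qed.

Lemma zero_board n :
  is_rook (const_mx false : 'M_n) && on_triangle (const_mx false : 'M_n).
Proof. by apply/board_rook_spec; split=> >; rewrite mxE. Qed.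

Lemma ext_direct_sum_board m n (R : board_rook m) (S : board_rook n) :
  is_rook (ext_direct_sum R S) && on_triangle (ext_direct_sum R S).
Proof.
apply: direct_sum_board (board_rookP S).
exact: direct_sum_board (board_rookP R) (zero_board 1).
Qed.

Definition rook_mul (r s : rook) : rook :=
  match r, s with
  | UnitRook, _ => s
  | _, UnitRook => r
  | Rook _ A, Rook _ B => Rook (BoardRook (ext_direct_sum_board A B))
  end.

Definition entry n (R : 'M[bool]_n) (i j : nat) : bool :=
  if (insub i, insub j) is (Some i', Some j') then R i' j' else false.

Lemma entryE n (R : 'M[bool]_n) (i j : 'I_n) : entry R i j = R i j.
Proof. by rewrite /entry !valK. Qed.

Lemma entry_out n (R : 'M[bool]_n) (i j : nat) :
  ~~ ((i < n) && (j < n))%N -> entry R i j = false.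
Proof.
rewrite negb_and /entry => /orP[] h; first by rewrite insubN.
by case: insub => // i'; rewrite insubN.
Qed.

Lemma entry_direct_sum m n (R : 'M[bool]_m) (S : 'M[bool]_n) i j :
  entry (direct_sum R S) i j =
  entry R i j || [&& (m <= i)%N, (m <= j)%N & entry S (i - m) (j - m)].
Proof.
have [/andP[lti ltj]|out] := boolP ((i < m + n) && (j < m + n))%N; last first.
  rewrite entry_out //.
  rewrite entry_out; last first.
    apply: contra out => /andP[hi hj].
    by rewrite !(leq_trans _ (leq_addr _ _)).
  symmetry; apply/negP => /and3P[mi mj] S_ij; case/negP: out.
  have : ((i - m < n) && (j - m < n))%N.
    by apply: contraT => /(entry_out S); rewrite S_ij.
  by rewrite !ltn_subLR.
rewrite -[i]/(val (Ordinal lti)) -[j]/(val (Ordinal ltj)) entryE.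
move: (Ordinal lti) (Ordinal ltj) => a b.
rewrite -(fintype.splitK a) -(fintype.splitK b).
case: (fintype.split a) (fintype.split b) => i' [] j' /=.
- by rewrite block_mxEul entryE leqNgt ltn_ord orbF.
- rewrite block_mxEur mxE leqNgt ltn_ord orbF entry_out //.
  by rewrite negb_and -!leqNgt leq_addr orbT.
- rewrite block_mxEdl mxE (leqNgt m j') ltn_ord andbF orbF entry_out //.
  by rewrite negb_and -!leqNgt leq_addr.
- rewrite block_mxEdr !leq_addr !addKn entryE entry_out //.
  by rewrite negb_and -!leqNgt leq_addr.
Qed.

Lemma rook_eq m n (R : board_rook m) (S : board_rook n) :
  m = n -> (forall i j, entry R i j = entry S i j) -> Rook R = Rook S.
Proof.
move=> eq_mn; case: n / eq_mn S => S eqRS; congr Rook; apply: val_inj.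
by apply/matrixP => i j; rewrite -!entryE eqRS.
Qed.

Lemma rook_mulA : associative rook_mul.
Proof.
move=> [|m R] [|n S] [|p T] //=; apply: rook_eq => [|i j].
  by rewrite !addnA.
rewrite /= /ext_direct_sum !entry_direct_sum.
have e0 a b : entry (const_mx false : 'M_1) a b = false.
  by rewrite /entry; do 2![case: insub => //= ?]; rewrite mxE.
rewrite !e0 !andbF !orbF !subnDA.
set x := entry T _ _; rewrite -orbA; congr (_ || _).
rewrite !andb_orr; congr (_ || _).
have E k : (m + 1 + n + 1 <= k)%N =
    (m + 1 <= k)%N && (n + 1 <= k - m - 1)%N.
  by lia.
by rewrite !E; do 4?[case: (_ <= _)%N].
Qed.

Lemma rook_mul1l : left_id UnitRook rook_mul. Proof. by []. Qed.
Lemma rook_mul1r : right_id UnitRook rook_mul. Proof. by case. Qed.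

Lemma rook_mul_unit r s : rook_mul r s = UnitRook -> r = UnitRook /\ s = UnitRook.
Proof. by case: r s => [|m R] [|n S]. Qed.

(* With this monoid structure the monoid algebra {malg rat[rook]} is QR.      *)
HB.instance Definition _ := Choice_isMonomialDef.Build rook
  rook_mulA rook_mul1l rook_mul1r rook_mul_unit.

Definition adjacent n (P : {set {set 'I_n}}) (a b : 'I_n) : bool :=
  [exists B in P, [&& a \in B, b \in B, (a < b)%N &
     [forall c in B, ~~ (a < c < b)%N]]].

(* Elements of [n + 1] and matrix indices are both shifted to start at 0, so  *)
(* that entry (i, j) still compares the elements i and j + 1.                 *)
Definition rook_mx n (P : setpart n.+1) : 'M[bool]_n :=
  \matrix_(i, j) adjacent P (widen_ord (leqnSn n) i) (lift ord0 j).

Lemma rook_mx_board n (P : setpart n.+1) :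
  is_rook (rook_mx P) && on_triangle (rook_mx P).
Proof.
have /and3P[_ tiP _] := setpartP P.
have same B C (x : 'I_n.+1) : B \in blocks P -> C \in blocks P ->
    x \in B -> x \in C -> B = C.
  by move=> PB PC xB xC; rewrite -(def_pblock tiP PB xB) (def_pblock tiP PC xC).
apply/board_rook_spec; split=> [i j1 j2|i1 i2 j|i j]; rewrite !mxE.
- move=> /exists_inP[B PB /and4P[iB j1B lt1 /forall_inP no1]].
  move=> /exists_inP[C PC /and4P[iC j2C lt2 /forall_inP no2]].
  have eBC := same _ _ _ PB PC iB iC; rewrite -{}eBC in j2C no2.
  have := no1 _ j2C; have := no2 _ j1B; rewrite lt1 lt2 /= -!leqNgt => le21 le12.
  apply: (@lift_inj _ ord0); apply: val_inj; apply/eqP.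
  by rewrite eqn_leq le21 le12.
- move=> /exists_inP[B PB /and4P[i1B jB lt1 /forall_inP no1]].
  move=> /exists_inP[C PC /and4P[i2C jC lt2 /forall_inP no2]].
  have eBC := same _ _ _ PB PC jB jC; rewrite -{}eBC in i2C no2.
  have := no1 _ i2C; have := no2 _ i1B; rewrite lt1 lt2 !andbT -!leqNgt.
  move=> le12 le21; apply: val_inj; apply/eqP.
  by rewrite eqn_leq le12 le21.
- by move=> /exists_inP[B _ /and4P[_ _ + _]] /=; rewrite /bump /= ltnS.
Qed.

Definition rook_of_setpart n : setpart n -> rook :=
  match n with
  | 0 => fun _ => UnitRook
  | n'.+1 => fun P => Rook (BoardRook (rook_mx_board P))
  end.

(* Main.v *)
Require Import Defs.
From HB Require Import structures.
From mathcomp Require Import all_boot all_order all_algebra all_fingroup.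
From mathcomp Require Import boolp zify.
From mathcomp Require Import finmap monalg.

(** Everything is read on words. A word w of length n has a kernel, the
relation identifying the positions that carry the same letter; every partition
of [n] is such a kernel, and a series lies in NCSym only if its coefficient at
w depends on the kernel of w alone, since a bijection between the letters of
two words with the same kernel extends to a permutation of finitely many
variables (ncsym_word).

The rook of a partition records which positions are consecutive in a block,
and these pairs generate the whole partition. Hence power_sum P is the
indicator of the words w such that w_i = w_(j+1) for all (i, j) in the rook of
P (rook_sum_setpart). Described in this way, p becomes visibly multiplicative:
the zero row and column inserted by the extended direct sum are what prevents
any condition from linking the last letter of the first factor to the first
letter of the second, so a word satisfies the conditions of R (+) S exactly
when its two halves satisfy those of R and of S (compat_cat).

Moreover every rook on the triangle is the rook of some partition
(board_adjacency): following each entry (i, j) as an arrow from j + 1 down to i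
leads every position to a root, and the rows and columns holding at most
one entry make the positions with a given root a chain.

So R |-> p_R extends to an algebra morphism rook_expansion from the monoid
algebra of rooks to NCSym, and the required map is its inverse. Bijectivity is
triangularity: choose for each rook R a word w_R whose kernel has rook R. The
coefficient of p_S at w_R is 1 if the kernel of w_S is contained in that of
w_R and 0 otherwise, so it is 1 for S = R, and the other S for which it is 1
have fewer pairs of equal letters (compat_triangular). Injectivity follows by
looking at a minimal rook of the support; surjectivity by clearing the
coefficients at the w_R in increasing order of the number of pairs, which
terminates because the degree is bounded. *)

Set Implicit Arguments.
Unset Strict Implicit.
Unset Printing Implicit Defensive.

Import GRing.Theory.

Local Open Scope ring_scope.

(** * Kernels and their rooks *)

Definition kernel_le (n : nat) (T T' : Type) (g : nat -> T) (h : nat -> T') :=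
  forall a b, (a < n)%N -> (b < n)%N -> g a = g b -> h a = h b.

Definition adjacency n (T : eqType) (g : nat -> T) : 'M[bool]_n :=
  \matrix_(i, j) [&& (i <= j)%N, g i == g j.+1 &
                     all (fun k => g k != g i) (index_iota i.+1 j.+1)].

Lemma adjacencyP n (T : eqType) (g : nat -> T) (i j : 'I_n) :
  reflect [/\ (i <= j)%N, g i = g j.+1 &
              forall k, (i < k <= j)%N -> g k <> g i]
          (adjacency n g i j).
Proof.
rewrite mxE.
apply: (iffP and3P) => [[le_ij /eqP eq_ij /allP no]|[le_ij eq_ij no]].
  by split=> // k ik; apply/eqP/no; rewrite mem_index_iota ltnS.
split=> //; first exact/eqP.
by apply/allP=> k; rewrite mem_index_iota ltnS => /no /eqP.
Qed.

Lemma adjacency_board n (T : eqType) (g : nat -> T) :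
  is_rook (adjacency n g) && on_triangle (adjacency n g).
Proof.
apply/board_rook_spec; split=> [i j1 j2|i1 i2 j|i j].
- move=> /adjacencyP[le1 eq1 no1] /adjacencyP[le2 eq2 no2].
  apply: val_inj => /=; case: (ltngtP j1 j2) => // lt.
    by case: (no2 j1.+1); rewrite // lt ltnS le1.
  by case: (no1 j2.+1); rewrite // lt ltnS le2.
- move=> /adjacencyP[le1 eq1 no1] /adjacencyP[le2 eq2 no2].
  apply: val_inj => /=; case: (ltngtP i1 i2) => // lt.
    by case: (no1 i2); rewrite ?lt ?le2 // eq2.
  by case: (no2 i1); rewrite ?lt ?le1 // eq1.
- by case/adjacencyP.
Qed.

Lemma eq_adjacency n (T T' : eqType) (g : nat -> T) (h : nat -> T') :
  kernel_le n.+1 g h -> kernel_le n.+1 h g -> adjacency n g = adjacency n h.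
Proof.
have sub (U U' : eqType) (u : nat -> U) (v : nat -> U') i j :
    kernel_le n.+1 u v -> kernel_le n.+1 v u ->
    adjacency n u i j -> adjacency n v i j.
  move=> uv vu /adjacencyP[le_ij eq_ij no]; apply/adjacencyP.
  have lt_i : (i < n.+1)%N by rewrite ltnS ltnW.
  split=> // [|k ikj eq_k].
    by apply: uv; rewrite // ltnS.
  case/andP: (ikj) => _ lekj.
  apply: no ikj _; apply: vu eq_k => //.
  by rewrite ltnS (leq_trans lekj) // ltnW.
by move=> gh hg; apply/matrixP=> i j; apply/idP/idP; apply: sub.
Qed.

(** Two positions of the same class are joined by a chain of consecutive ones,
so the conditions at the entries of the rook propagate to the whole kernel. *)
Lemma adjacency_kernel n (T : eqType) (T' : Type)
    (g : nat -> T) (h : nat -> T') :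
  (forall i j : 'I_n, adjacency n g i j -> h i = h j.+1) <->
  kernel_le n.+1 g h.
Proof.
split=> [adj|gh i j /adjacencyP[le_ij eq_ij _]]; last first.
  by apply: gh (eq_ij); rewrite ltnS // ltnW.
suff le a b : (a <= b)%N -> (b <= n)%N -> g a = g b -> h a = h b.
  move=> a b; rewrite !ltnS => lea leb eq_ab.
  by case/orP: (leq_total a b) => le_ab; [|symmetry]; apply: le.
elim/ltn_ind: b a => -[|b] IHb a; first by rewrite leqn0 => /eqP->.
rewrite leq_eqVlt ltnS => /predU1P[-> //|le_ab] lt_b eq_ab.
(* c is the element of the class of b.+1 that immediately precedes it. *)
have ex_c : exists c, (c <= b)%N && (g c == g b.+1).
  by exists a; rewrite le_ab eq_ab /=.
have ub_c c : (c <= b)%N && (g c == g b.+1) -> (c <= b)%N by case/andP.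
case: (ex_maxnP ex_c ub_c) => c /andP[le_cb /eqP eq_c] max_c.
have lt_c := leq_ltn_trans le_cb lt_b.
have <- : h c = h b.+1.
  apply: (adj (Ordinal lt_c) (Ordinal lt_b)); apply/adjacencyP; split=> //= k.
  move=> /andP[lt_ck le_kb] eq_k.
  by have := max_c k; rewrite le_kb eq_k eq_c eqxx leqNgt lt_ck => /(_ isT).
apply: IHb; rewrite ?eq_ab // ?(ltnW lt_c) //.
by apply: max_c; rewrite le_ab eq_ab /=.
Qed.

(** An entry (i, j) makes i the parent of j + 1; the root of a position is its
oldest ancestor. The last clause says, contrapositively, that a position without
a parent is its own root. *)
Lemma rook_root n (R : board_rook n) : exists root : nat -> nat,
  [/\ forall b, (root b <= b)%N,
      forall i j : 'I_n, R i j -> root j.+1 = root i &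
      forall b, (b <= n)%N -> (root b < b)%N ->
        exists i j : 'I_n, b = j.+1 /\ R i j].
Proof.
have [_ colR leR] := board_rook_spec R (board_rookP R).
(* The pick is unambiguous since a column of R has at most one entry. *)
pose parent b := if [pick ij : 'I_n * 'I_n | (b == ij.2.+1) && R ij.1 ij.2]
  is Some ij then val ij.1 else b.
have parentR (i j : 'I_n) : R i j -> parent j.+1 = i.
  rewrite /parent => Rij; case: pickP => [[i' j'] /= /andP[/eqP[ej] R']|].
    by have eqj := val_inj ej; rewrite (colR i' i j') // -eqj.
  by move/(_ (i, j)); rewrite /= eqxx Rij.
have parent_le b : (parent b <= b)%N.
  rewrite /parent; case: pickP => // -[i j] /= /andP[/eqP-> Rij].
  exact/leqW/leR.
have iter_le m b : (iter m parent b <= b)%N.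
  by elim: m => //= m /(leq_trans (parent_le _)).
(* Each step to a proper parent loses at least one, so that n steps from a
   position b <= n reach a root. *)
have iter_fix m b : parent (iter m parent b) = iter m parent b \/
    (iter m parent b + m <= b)%N.
  elim: m => [|m [IH|IH]] /=; first by right; rewrite addn0.
    by left; rewrite !IH.
  have := parent_le (iter m parent b).
  rewrite leq_eqVlt => /predU1P[eq_p|lt_p]; first by left; rewrite !eq_p.
  by right; apply: leq_trans IH; rewrite addnS -addSn leq_add2r.
have root_parent b : (b <= n)%N -> iter n parent (parent b) = iter n parent b.
  move=> le_b; rewrite -iterSr /=; case: (iter_fix n b) => // le.
  have -> : iter n parent b = 0%N by lia.
  by apply/eqP; rewrite -leqn0.
exists (iter n parent); split=> // [i j Rij|b le_b].
  by rewrite -(parentR i j Rij) root_parent.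
have [eq_b|ne_b] := eqVneq (parent b) b.
  have -> : iter n parent b = b by elim: (n) => //= m ->.
  by rewrite ltnn.
move=> _; move: ne_b; rewrite /parent.
case: pickP => [[i j]|]; last by rewrite eqxx.
by case/andP=> /eqP-> Rij _; exists i, j.
Qed.

(** The classes of the root function are chains of arrows, so their consecutive
pairs are exactly the entries of R. *)
Lemma board_adjacency n (R : board_rook n) :
  exists g : nat -> nat, adjacency n g = R.
Proof.
have [rowR colR leR] := board_rook_spec R (board_rookP R).
have [root [root_le rootR rootN]] := rook_root R.
exists root.
(* The arrow from j + 1 to i cannot jump over a position a of the same class.
   If a has parent p = i, then a = j + 1, as row i has at most one entry; and if
   p <> i, then the arrow into the smaller of i and p would jump over the
   larger one, which is below a. *)
have no_cross (a : nat) (i j : 'I_n) :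
    (a <= n)%N -> (i < a)%N -> root i = root a -> R i j -> (j < a)%N.
  elim/ltn_ind: a i j => a IHa i j le_a lt_ia eq_root Rij.
  have [|p [q [def_a Rpq]]] := rootN a le_a.
    by rewrite -eq_root; apply: leq_ltn_trans (root_le i) lt_ia.
  subst a.
  have eq_p : root p = root i by rewrite -(rootR _ _ Rpq) eq_root.
  case: (ltngtP i p) => [lt_ip|lt_pi|/val_inj eq_ip].
  - have le_pq := leR _ _ Rpq.
    by have := IHa p le_pq i j (ltnW (ltn_ord p)) lt_ip (esym eq_p) Rij; lia.
  - by have := IHa i lt_ia p q (ltnW (ltn_ord i)) lt_pi eq_p Rpq; lia.
  - by subst p; rewrite (rowR i j q).
apply/matrixP=> i j; apply/idP/idP.
- move=> /adjacencyP[le_ij eq_ij no].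
  have [//||p [q [[/val_inj def_q] Rpq]]] := rootN j.+1.
    by rewrite -eq_ij; apply: leq_ltn_trans (root_le i) _; rewrite ltnS.
  subst q; have le_pj := leR _ _ Rpq.
  have eq_p : root p = root i by rewrite eq_ij (rootR _ _ Rpq).
  case: (ltngtP i p) => [lt_ip|lt_pi|/val_inj-> //].
    by case: (no p); rewrite ?lt_ip ?le_pj.
  by have := no_cross i p j (ltnW (ltn_ord i)) lt_pi eq_p Rpq; lia.
- move=> Rij; apply/adjacencyP.
  split; [exact: leR | by rewrite (rootR _ _ Rij) |].
  move=> k /andP[lt_ik le_kj] eq_k; have lt_j := ltn_ord j.
  by have := no_cross k i j _ lt_ik (esym eq_k) Rij; lia.
Qed.

(** * Words and the invariance of symmetric series *)

(** One transposition per index corrects the permutation found so far; it fixes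
the values already matched. *)
Lemma perm_matching (T : finType) (I : eqType) (x y : I -> T) (r : seq I) :
  {in r &, forall i j, x i = x j <-> y i = y j} ->
  exists s : {perm T}, {in r, forall i, s (x i) = y i}.
Proof.
elim: r => [|i r IHr] xy; first by exists 1%g.
have [j k jr kr|s s_r] := IHr; first by apply: xy; rewrite inE ?jr ?kr orbT.
exists (s * tperm (s (x i)) (y i))%g => j; rewrite inE permM => /predU1P[->|jr].
  by rewrite tpermL.
have ij := xy i j; rewrite !inE eqxx jr orbT in ij.
have [eq_x|ne_x] := eqVneq (x i) (x j).
  by rewrite eq_x tpermL; case: ij => // /(_ eq_x).
rewrite (s_r j jr) tpermD //.
  by rewrite -(s_r j jr) (inj_eq perm_inj).
by apply: contra ne_x => /eqP eq_y; apply/eqP; case: ij => // _; apply.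
Qed.

Definition word_le (w w' : seq nat) :=
  size w' = size w /\ kernel_le (size w) (nth 0%N w) (nth 0%N w').

Lemma word_le_refl w : word_le w w.
Proof. by split. Qed.

(** Words with the same kernel differ by a bijection of their letters, hence by
the action of a permutation of the variables of index below some m. *)
Lemma ncsym_word (f : ncseries) w w' :
  f \in ncsym_pred -> word_le w w' -> word_le w' w -> f w = f w'.
Proof.
move=> /ncsym_predP[_ sym_f] [sz ww'] [_ w'w].
pose m := (\max_(a <- w ++ w') a).+1.
have ltm a : a \in w ++ w' -> (a < m)%N.
  by move=> ain; rewrite ltnS; apply: leq_bigmax_seq.
have ltx i : i \in iota 0 (size w) ->
    (nth 0%N w i < m)%N /\ (nth 0%N w' i < m)%N.
  rewrite mem_iota => lti.
  by split; apply: ltm; rewrite mem_cat mem_nth ?orbT // sz.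
have [s s_w] : exists s : 'S_m, {in iota 0 (size w), forall i,
    s (inord (nth 0%N w i)) = inord (nth 0%N w' i)}.
  apply: perm_matching => i j ir jr.
  have [[wi w'i] [wj w'j]] := (ltx i ir, ltx j jr).
  move: ir jr; rewrite !mem_iota /= => ir jr.
  split=> /(congr1 (@nat_of_ord _)); rewrite !inordK // => eq_ij; congr inord.
    exact: ww'.
  by apply: w'w; rewrite ?sz.
rewrite -{1}(sym_f m s) /act_series; congr f.
apply: (@eq_from_nth _ 0%N) => [|i]; rewrite size_map // => lti.
have [ltw ltw'] : (nth 0%N w i < m)%N /\ (nth 0%N w' i < m)%N.
  by apply: ltx; rewrite mem_iota.
rewrite (nth_map 0%N) // invgK /perm_ext insubT.
rewrite (_ : Sub _ _ = inord (nth 0%N w i)); last first.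
  by apply: val_inj; rewrite /= inordK.
by rewrite s_w ?mem_iota //= inordK.
Qed.

(** * Power sums indexed by rooks *)

(** The n such that the rook is that of a partition of [n]. Unlike the size of
the matrix, it is additive for the product. *)
Definition rook_size (r : rook) : nat := if r is Rook n _ then n.+1 else 0%N.

Definition rook_entry (r : rook) (i j : nat) : bool :=
  if r is Rook n R then entry R i j else false.

Lemma rook_entry_lt r i j : rook_entry r i j ->
  (i.+1 < rook_size r)%N && (j.+1 < rook_size r)%N.
Proof.
case: r => [|n R] //=; rewrite !ltnS.
by apply: contraTT => /(entry_out R)->.
Qed.

(** The monomials of the power sum of the partition whose rook is r. *)
Definition compat (r : rook) (w : seq nat) : bool :=
  (size w == rook_size r) &&
  [forall i : 'I_(rook_size r), forall j : 'I_(rook_size r),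
     rook_entry r i j ==> (nth 0%N w i == nth 0%N w j.+1)].

Lemma compatP r w :
  reflect (size w = rook_size r /\
           forall i j, rook_entry r i j -> nth 0%N w i = nth 0%N w j.+1)
          (compat r w).
Proof.
apply: (iffP andP) => -[/eqP sz adj]; split=> //.
  move=> i j rij; have /andP[/ltnW lti /ltnW ltj] := rook_entry_lt rij.
  have /forallP/(_ (Ordinal ltj))/implyP := forallP adj (Ordinal lti).
  by move/(_ rij)/eqP.
by apply/forallP=> i; apply/forallP=> j; apply/implyP=> /adj/eqP.
Qed.

Definition rook_of_word (w : seq nat) : rook :=
  if size w is n.+1 then Rook (BoardRook (adjacency_board n (nth 0%N w)))
  else UnitRook.

Lemma compat_rook_of_word w w' :
  reflect (word_le w w') (compat (rook_of_word w) w').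
Proof.
apply: (iffP (compatP _ _)); rewrite /word_le /rook_of_word.
  case: (size w) => [|n] [sz adj]; split=> //.
  by apply/adjacency_kernel => i j; rewrite -(entryE (adjacency n _));
    apply: adj.
case: (size w) => [|n] [sz le]; split=> // i j ij.
have /andP[lti ltj] : (i < n)%N && (j < n)%N by have := rook_entry_lt ij.
have /adjacency_kernel/(_ (Ordinal lti) (Ordinal ltj)) := le.
by apply; rewrite -entryE.
Qed.

Lemma eq_rook_of_word w w' :
  word_le w w' -> word_le w' w -> rook_of_word w = rook_of_word w'.
Proof.
rewrite /rook_of_word => -[sz le1] [_]; rewrite sz => le2.
case: (size w) le1 le2 => // n le1 le2; congr Rook; apply: val_inj.
exact: eq_adjacency.
Qed.

Lemma rook_of_word_surj r : exists w, rook_of_word w == r.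
Proof.
case: r => [|n R]; first by exists [::].
have [g gR] := board_adjacency R.
exists (mkseq g n.+1); apply/eqP; rewrite /rook_of_word size_mkseq.
congr Rook; apply: val_inj; rewrite /= -gR.
by apply: eq_adjacency => a b lta ltb; rewrite !nth_mkseq.
Qed.

(** A word is chosen for each rook, to test the coefficients of a series on. *)
Definition rook_word (r : rook) : seq nat := xchoose (rook_of_word_surj r).

Lemma rook_wordK r : rook_of_word (rook_word r) = r.
Proof. exact/eqP/(xchooseP (rook_of_word_surj r)). Qed.

Lemma compat_rook_word r w : reflect (word_le (rook_word r) w) (compat r w).
Proof. by rewrite -{2}(rook_wordK r); apply: compat_rook_of_word. Qed.

Lemma rook_mul_size r s :
  rook_size (rook_mul r s) = (rook_size r + rook_size s)%N.
Proof. by case: r s => [|m R] [|n S] //=; rewrite ?addn0 // addn1 addnS. Qed.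

Lemma rook_mul_entry r s i j : rook_entry (rook_mul r s) i j =
  rook_entry r i j || [&& (rook_size r <= i)%N, (rook_size r <= j)%N &
                        rook_entry s (i - rook_size r) (j - rook_size r)].
Proof.
case: r s => [|m R] [|n S] //=; rewrite ?subn0 ?andbF ?orbF //.
rewrite /ext_direct_sum !entry_direct_sum addn1.
have -> : entry (const_mx false : 'M_1) (i - m) (j - m) = false.
  by rewrite /entry; do 2![case: insub => //= ?]; rewrite mxE.
by rewrite !andbF orbF.
Qed.

(** The entries of r have indices below rook_size r - 1 and compare letters of
u; those of s are shifted by rook_size r, past the zero row and column, and
compare letters of v. *)
Lemma compat_cat r s u v : size u = rook_size r ->
  compat (rook_mul r s) (u ++ v) = compat r u && compat s v.
Proof.
move=> sz_u; apply/compatP/andP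
  => [[sz adj]|[/compatP[_ adj_u] /compatP[sz_v adj_v]]].
  split; apply/compatP; split=> //.
  - move=> i j ij; have /andP[lti ltj] := rook_entry_lt ij.
    have := adj i j; rewrite rook_mul_entry ij => /(_ isT).
    by rewrite !nth_cat sz_u ltj ltnW.
  - by move: sz; rewrite size_cat rook_mul_size sz_u => /addnI.
  - move=> i j ij; have := adj (rook_size r + i)%N (rook_size r + j)%N.
    rewrite rook_mul_entry !leq_addr !addKn ij orbT => /(_ isT).
    by rewrite -addnS !nth_cat sz_u !ltnNge !leq_addr /= !addKn.
split=> [|i j]; first by rewrite size_cat rook_mul_size sz_u sz_v.
rewrite rook_mul_entry => /orP[ij|/and3P[le_i le_j ij]].
  have /andP[lti ltj] := rook_entry_lt ij.
  by rewrite !nth_cat sz_u ltj ltnW // (adj_u _ _ ij).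
by rewrite !nth_cat sz_u !ltnNge le_i leqW //= subSn // (adj_v _ _ ij).
Qed.

Definition rook_series (r : rook) : ncseries := fun w => (compat r w)%:R.

(** Only the factorization of w at position rook_size r contributes. *)
Lemma rook_series_mul r s :
  rook_series (rook_mul r s) = rook_series r * rook_series s.
Proof.
apply/funext => w.
transitivity (\sum_(i < (size w).+1)
    rook_series r (take i w) * rook_series s (drop i w)); last by [].
rewrite /rook_series.
have zero (i : 'I_(size w).+1) : nat_of_ord i != rook_size r ->
    (compat r (take i w))%:R * (compat s (drop i w))%:R = 0 :> rat.
  move=> ne_i; rewrite (_ : compat r _ = false) ?mul0r //.
  by rewrite /compat size_takel ?(negbTE ne_i) // -ltnS.
have [lt_r|ge_r] := ltnP (rook_size r) (size w).+1; last first.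
  rewrite big1 => [|i _]; last first.
    by apply: zero; rewrite ltn_eqF // (leq_trans (ltn_ord i)).
  rewrite /compat rook_mul_size ltn_eqF //.
  exact: leq_trans ge_r (leq_addr _ _).
rewrite (bigD1 (Ordinal lt_r)) //= [X in _ + X]big1 ?addr0 => [|i ne_i].
  2: exact: zero.
rewrite -{1}(cat_take_drop (rook_size r) w) compat_cat ?size_takel //.
by rewrite -natrM mulnb.
Qed.

Lemma rook_series_unit : rook_series UnitRook = 1.
Proof.
apply/funext => w; congr (_%:R); congr nat_of_bool.
by apply/compatP/eqP => [[/size0nil]|->].
Qed.

Lemma rook_series_ncsym r : rook_series r \in ncsym_pred.
Proof.
apply/ncsym_predP; split=> [|m s].
  by exists (rook_size r) => w ltw; rewrite /rook_series /compat gtn_eqF.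
apply/funext => w; congr (_%:R); congr nat_of_bool.
have nth_act i : (i < size w)%N ->
    nth 0%N (act_word s^-1 w) i = perm_ext s^-1^-1 (nth 0%N w i).
  by move=> lti; rewrite (nth_map 0%N).
have lt_ij i j : size w = rook_size r -> rook_entry r i j ->
    (i < size w)%N && (j.+1 < size w)%N.
  by move=> -> /rook_entry_lt/andP[/ltnW-> ->].
apply/compatP/compatP; rewrite size_map => -[sz adj]; split=> // i j ij.
  have /andP[lti ltj] := lt_ij i j sz ij.
  by have := adj i j ij; rewrite !nth_act // => /perm_ext_inj.
have /andP[lti ltj] := lt_ij i j sz ij.
by rewrite !nth_act // (adj _ _ ij).
Qed.

Definition rook_sum (r : rook) : NCSym := MkNCSym (rook_series_ncsym r).

(** * Set partitions as kernels of words *)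

Lemma word_part_block n w (B : {set 'I_n}) : B \in word_part n w ->
  exists x : 'I_n,
    x \in B /\ forall y, (y \in B) = (nth 0%N w x == nth 0%N w y).
Proof. by case/imsetP=> x _ ->; exists x; split=> [|y]; rewrite !inE ?eqxx. Qed.

Lemma word_part_class n w (x : 'I_n) :
  [set y : 'I_n | nth 0%N w x == nth 0%N w y] \in word_part n w.
Proof. by apply/imsetP; exists x => //; apply/setP=> y; rewrite !inE. Qed.

Lemma setpart_word n (P : setpart n) :
  exists2 w, size w = n & word_part n w = P.
Proof.
pose w := [seq index (pblock P i) (enum (blocks P)) | i <- enum 'I_n].
have wE (i : 'I_n) : nth 0%N w i = index (pblock P i) (enum (blocks P)).
  by rewrite (nth_map i) ?nth_ord_enum // size_enum_ord.
exists w; first by rewrite size_map size_enum_ord.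
rewrite -[RHS](preim_partition_pblock (setpartP P)).
have inP i : pblock P i \in enum (blocks P).
  by rewrite mem_enum pblock_mem // (cover_partition (setpartP P)) inE.
apply: eq_imset => i; apply/setP=> j; rewrite !inE /= !wE.
apply/eqP/eqP=> [/(congr1 (nth set0 (enum (blocks P))))|-> //].
by rewrite !nth_index.
Qed.

Lemma word_partP n w : partition (word_part n w) [set: 'I_n].
Proof. exact: preim_partitionP. Qed.

Lemma refines_word_part n w w' :
  reflect (kernel_le n (nth 0%N w) (nth 0%N w'))
          (refines (word_part n w) (word_part n w')).
Proof.
apply: (iffP forall_inP)
  => [ref a b lta ltb eq_ab|le B /word_part_block[x [_ Bx]]].
  have /exists_inP[C /word_part_block[c [_ defC]] /subsetP sub] :=
    ref _ (word_part_class w (Ordinal lta)).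
  have := sub (Ordinal lta); have := sub (Ordinal ltb).
  by rewrite !inE /= eq_ab eqxx !defC => /(_ isT)/eqP<- /(_ isT)/eqP<-.
apply/exists_inP; exists [set y : 'I_n | nth 0%N w' x == nth 0%N w' y].
  exact: word_part_class.
by apply/subsetP=> y; rewrite Bx inE => /eqP eq_xy; apply/eqP/le.
Qed.

(** The rook of a partition depends on the kernel of a word only, so that
properties proved on words transfer to partitions. *)
Lemma rook_of_setpartE n (P : setpart n) w :
  size w = n -> word_part n w = P -> rook_of_setpart P = rook_of_word w.
Proof.
case: n P => [|n] P sz defP; rewrite /rook_of_word sz //=.
congr Rook; apply: val_inj; apply/matrixP=> i j; rewrite mxE -defP /=.
apply/exists_inP/adjacencyP => [[B]|[le_ij eq_ij no]].
  case/word_part_block=> x [_ Bx] /and4P[].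
  rewrite !Bx /= /bump leq0n add1n ltnS => /eqP<- /eqP<- le_ij /forall_inP no.
  split=> //.
  move=> k /andP[lt_ik le_kj] eq_k.
  have lt_k : (k < n.+1)%N by rewrite ltnS (leq_trans le_kj) // ltnW.
  have := no (Ordinal lt_k); rewrite Bx /= eq_k eqxx => /(_ isT).
  by rewrite lt_ik ltnS le_kj.
exists [set y : 'I_n.+1 | nth 0%N w i == nth 0%N w y].
  exact: (word_part_class w (widen_ord (leqnSn n) i)).
rewrite !inE /= /bump leq0n add1n ltnS le_ij -eq_ij eqxx /=.
apply/forall_inP=> k; rewrite inE => /eqP eq_k; apply/negP; rewrite ltnS => ikj.
by case: (no k ikj).
Qed.

Lemma rook_of_setpart_surj r : exists n (P : setpart n), rook_of_setpart P = r.
Proof.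
exists (size (rook_word r)), (SetPart (word_partP _ (rook_word r))).
by rewrite -[RHS]rook_wordK; apply: rook_of_setpartE.
Qed.

Lemma rook_sum_setpart n (P : setpart n) :
  rook_sum (rook_of_setpart P) = power_sum P.
Proof.
have [w sz defP] := setpart_word P.
apply: val_inj; apply/funext => w' /=.
rewrite /rook_series /power_sum_series (rook_of_setpartE sz defP) -defP.
congr (_%:R); congr nat_of_bool.
apply/compat_rook_of_word/andP; rewrite /word_le sz => -[].
  by move=> -> /refines_word_part.
by move=> /eqP-> /refines_word_part.
Qed.

(** * Triangularity *)

Definition kernel_pairs n (w : seq nat) : {set 'I_n * 'I_n} :=
  [set ab | nth 0%N w (val ab.1) == nth 0%N w (val ab.2)].

Definition kernel_size (w : seq nat) : nat := #|kernel_pairs (size w) w|.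

Lemma kernel_size_le w : (kernel_size w <= size w * size w)%N.
Proof. by rewrite (leq_trans (max_card _)) // card_prod card_ord. Qed.

Lemma word_le_kernel_size w w' : word_le w w' ->
  (kernel_size w <= kernel_size w')%N /\
  ((kernel_size w' <= kernel_size w)%N -> word_le w' w).
Proof.
case=> sz le; rewrite /kernel_size /word_le sz.
have sub : kernel_pairs (size w) w \subset kernel_pairs (size w) w'.
  apply/subsetP=> -[a b]; rewrite !inE /= => /eqP eq_ab.
  by apply/eqP/le.
split=> [|ge]; first exact: subset_leq_card.
split=> // a b lta ltb eq_ab.
have := eqEcard (kernel_pairs (size w) w) (kernel_pairs (size w) w').
rewrite sub ge => /eqP/setP/(_ (Ordinal lta, Ordinal ltb)).
by rewrite !inE /= eq_ab eqxx => /eqP.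
Qed.

Lemma compat_self r : compat r (rook_word r).
Proof. by apply/compat_rook_word/word_le_refl. Qed.

(** Containment of kernels with equally many pairs is equality, and equal
kernels have the same rook. *)
Lemma compat_triangular r s :
  compat s (rook_word r) -> s != r ->
  (kernel_size (rook_word s) < kernel_size (rook_word r))%N.
Proof.
move=> /compat_rook_word le ne_sr.
have [_ ge] := word_le_kernel_size le.
rewrite ltnNge; apply: contra ne_sr => /ge ge_sr.
by rewrite -(rook_wordK s) -(rook_wordK r) (eq_rook_of_word le ge_sr).
Qed.

(** * The algebra morphism from rooks to symmetric series *)

Lemma rook_sum_mmorphism : mmorphism rook_sum.
Proof.
split=> [r s|]; apply: val_inj; first exact: rook_series_mul.
exact: rook_series_unit.
Qed.

HB.instance Definition _ :=
  isMultiplicative.Build rook NCSym rook_sum rook_sum_mmorphism.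

(** The inverse of the required isomorphism. *)
Definition rook_expansion : {malg rat[rook]} -> NCSym :=
  mmap (in_alg NCSym) rook_sum.

HB.instance Definition _ := GRing.Additive.on rook_expansion.

Lemma rook_expansion_scalable : scalable rook_expansion.
Proof. by move=> a c; rewrite /rook_expansion mmapZ /= mulr_algl. Qed.

HB.instance Definition _ := GRing.isScalable.Build rat {malg rat[rook]}
  NCSym *:%R rook_expansion rook_expansion_scalable.

Lemma rook_expansion_multiplicative : multiplicative rook_expansion.
Proof.
apply: commr_mmap_is_multiplicative => c r s.
by rewrite /GRing.comm /= mulr_algl mulr_algr.
Qed.

HB.instance Definition _ := GRing.isMultiplicative.Build {malg rat[rook]} NCSym
  rook_expansion rook_expansion_multiplicative.

Lemma rook_expansionU a r : rook_expansion << a *g r >> = a *: rook_sum r.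
Proof. by rewrite /rook_expansion mmapU /= mulr_algl. Qed.

Lemma ncsym_sumE (I : Type) (l : seq I) (P : pred I) (F : I -> NCSym) w :
  ncsym_val (\sum_(i <- l | P i) F i) w = \sum_(i <- l | P i) ncsym_val (F i) w.
Proof. by apply: (big_morph (fun f : NCSym => ncsym_val f w)). Qed.

Lemma size_rook_word r : size (rook_word r) = rook_size r.
Proof. by case/compatP: (compat_self r). Qed.

Lemma rook_expansionE c w :
  ncsym_val (rook_expansion c) w = \sum_(r <- msupp c) c@_r * (compat r w)%:R.
Proof.
rewrite ncsym_sumE; apply: eq_bigr => r _.
by rewrite /= mulr_algl.
Qed.

(** The test word of a rook of the support with the fewest pairs of equal
letters isolates its coefficient, by triangularity. *)
Lemma rook_expansion_inj : injective rook_expansion.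
Proof.
apply: raddf_inj => c c0; apply/eqP; rewrite -msupp_eq0; apply/eqP.
apply/fsetP=> r; rewrite in_fset0.
elim: {r}_.+1 {-2}r (ltnSn (kernel_size (rook_word r))) => // k IHk r lt_r.
apply/negP=> r_c; have := rook_expansionE c (rook_word r).
rewrite c0 (big_fsetD1 r) //= compat_self mulr1 big1_fset ?addr0.
  by move/esym/eqP; rewrite mcoeff_eq0 r_c.
move=> s; rewrite in_fsetD1 => /andP[ne_sr s_c] _.
case comp: (compat s _); last by rewrite mulr0.
have := compat_triangular comp ne_sr => lt_sr.
by rewrite IHk ?(leq_trans lt_sr) in s_c.
Qed.

Lemma finite_rooks d :
  exists l, uniq l /\ forall r, (r \in l) = (rook_size r <= d)%N.
Proof.
exists (undup (UnitRook ::
  flatten [seq [seq Rook R | R : board_rook n] | n <- iota 0 d])).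
split=> [|r]; first exact: undup_uniq.
rewrite mem_undup inE; apply/predU1P/idP => [[-> //|]|].
  by case/flatten_mapP=> n; rewrite mem_iota => ltn /imageP[R _ ->].
case: r => [|n R] /= lt_n; first by left.
right; apply/flatten_mapP; exists n; first by rewrite mem_iota.
by apply: image_f.
Qed.

(** Call level of a rook the number of pairs of equal letters in its test word.
The coefficients at the test words of level below k being already clear,
subtracting the combination of the power sums of level k whose coefficients
are read on the test words clears level k and leaves the lower levels at 0.
There are at most d * d + 1 levels to clear, a word of length at most d having
at most d * d pairs of positions. *)
Lemma rook_expansion_surj_from d k (f : NCSym) :
  (forall w, (d < size w)%N -> ncsym_val f w = 0) ->
  (forall r, (kernel_size (rook_word r) < k)%N ->
     ncsym_val f (rook_word r) = 0) ->
  exists c, rook_expansion c = f.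
Proof.
have [l [uniq_l mem_l]] := finite_rooks d.
move: {2}(_ - k)%N (leqnn ((d * d).+1 - k)) => m.
elim: m k f => [|m IHm] k f le_m deg_f low_f.
  exists 0; rewrite raddf0; apply: val_inj; apply/funext => w /=.
  rewrite (ncsym_word (ncsym_valP f) (w' := rook_word (rook_of_word w))).
  - have [le_w|/deg_f-> //] := leqP (size (rook_word (rook_of_word w))) d.
    rewrite low_f //; apply: leq_ltn_trans (kernel_size_le _) _.
    apply: leq_trans (_ : (d * d).+1 <= k)%N; last by rewrite -subn_eq0 -leqn0.
    by rewrite ltnS leq_mul.
  - apply/compat_rook_of_word; rewrite -{1}[rook_of_word w]rook_wordK.
    exact/compat_rook_of_word/word_le_refl.
  - by apply/compat_rook_word/compat_rook_of_word/word_le_refl.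
pose level r := kernel_size (rook_word r) == k.
pose c : {malg rat[rook]} :=
  \sum_(r <- l | level r) << ncsym_val f (rook_word r) *g r >>.
have cE w : ncsym_val (rook_expansion c) w =
    \sum_(r <- l | level r) ncsym_val f (rook_word r) * (compat r w)%:R.
  rewrite raddf_sum ncsym_sumE; apply: eq_bigr => r _.
  by rewrite /= rook_expansionU.
have [|||c' def_c'] := IHm k.+1 (f - rook_expansion c); first by lia.
- move=> w lt_w.
  transitivity (ncsym_val f w - ncsym_val (rook_expansion c) w) => //.
  rewrite deg_f // cE big_seq_cond big1 ?subr0 // => r /andP[].
  rewrite mem_l => le_r _; rewrite /compat gtn_eqF ?mulr0 //.
  exact: leq_ltn_trans lt_w.
- move=> r; rewrite ltnS => le_k.
  transitivity (ncsym_val f (rook_word r)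
                - ncsym_val (rook_expansion c) (rook_word r)) => //.
  rewrite cE; have [le_r|gt_r] := leqP (rook_size r) d; last first.
    rewrite deg_f ?size_rook_word // big_seq_cond big1 ?subr0 // => s /andP[].
    rewrite mem_l => le_s _; rewrite /compat size_rook_word gtn_eqF ?mulr0 //.
    exact: leq_ltn_trans gt_r.
  have zero s : level s -> s != r ->
      ncsym_val f (rook_word s) * (compat s (rook_word r))%:R = 0.
    move=> /eqP lev_s ne_sr; case comp: (compat s _); last by rewrite mulr0.
    by have := compat_triangular comp ne_sr; rewrite lev_s ltnNge le_k.
  have [lev_r|nlev_r] := boolP (level r).
    rewrite -big_filter (bigD1_seq r)
      ?filter_uniq ?mem_filter ?lev_r ?mem_l //=.
    rewrite compat_self mulr1 big_filter_cond big1 ?addr0 ?subrr // => s.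
    by case/andP=> lev_s ne_sr; exact: zero.
  rewrite low_f ?ltn_neqAle ?nlev_r // big1 ?subr0 // => s lev_s.
  by apply: zero => //; apply: contraNneq nlev_r => <-.
by exists (c' + c); rewrite raddfD /= def_c' subrK.
Qed.

Lemma rook_expansion_surj f : exists c, rook_expansion c == f.
Proof.
have /ncsym_predP[[d deg_f] _] := valP f.
have [|c <-] := @rook_expansion_surj_from d 0 f deg_f; first by [].
by exists c.
Qed.

Definition rook_of_ncsym (f : NCSym) : {malg rat[rook]} :=
  xchoose (rook_expansion_surj f).

Lemma rook_of_ncsymK : cancel rook_of_ncsym rook_expansion.
Proof. by move=> f; apply/eqP/(xchooseP (rook_expansion_surj f)). Qed.

Lemma rook_expansionK : cancel rook_expansion rook_of_ncsym.
Proof. by move=> c; apply: rook_expansion_inj; rewrite rook_of_ncsymK. Qed.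

HB.instance Definition _ := GRing.isZmodMorphism.Build NCSym {malg rat[rook]}
  rook_of_ncsym (can2_zmod_morphism rook_expansionK rook_of_ncsymK).
HB.instance Definition _ := GRing.isScalable.Build rat NCSym {malg rat[rook]}
  *:%R rook_of_ncsym (can2_scalable rook_expansionK rook_of_ncsymK).
HB.instance Definition _ := GRing.isMonoidMorphism.Build NCSym {malg rat[rook]}
  rook_of_ncsym (can2_monoid_morphism rook_expansionK rook_of_ncsymK).

Lemma rook_of_power_sum n (P : setpart n) :
  rook_of_ncsym (power_sum P) = << rook_of_setpart P >>.
Proof.
by rewrite -rook_sum_setpart -[rook_sum _]scale1r -rook_expansionU
  rook_expansionK.
Qed.

Theorem theorem2p3 :
  exists phi : {lrmorphism NCSym -> {malg rat[rook]}},
    [/\ forall (n : nat) (P : setpart n),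
          phi (power_sum P) = << rook_of_setpart P >>,
        forall psi : {linear NCSym -> {malg rat[rook]}},
          (forall (n : nat) (P : setpart n),
             psi (power_sum P) = << rook_of_setpart P >>) -> psi =1 phi
      & bijective phi].
Proof.
exists rook_of_ncsym; split; first exact: rook_of_power_sum.
  move=> psi psiP f; change (psi f = rook_of_ncsym f).
  rewrite -{1}(rook_of_ncsymK f); move: (rook_of_ncsym f) => c.
  rewrite [in LHS](monalgE c) [in RHS](monalgE c).
  rewrite (raddf_sum rook_expansion) (raddf_sum psi); apply: eq_bigr => r _.
  rewrite /= rook_expansionU linearZ /=.
  have [n [P <-]] := rook_of_setpart_surj r.
  by rewrite rook_sum_setpart psiP; apply/malgP=> s;
    rewrite mcoeffZ !mcoeffU mulr_natr.
exists rook_expansion; [exact: rook_of_ncsymK | exact: rook_expansionK].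
Qed.
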